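(* Let $G$ be a finitely generated group, $X$ a compact metric space and $\Phi\in Act(G,X)$. Then the following statements are equivalent: (i) $\Phi$ is expansive. (ii) $\Phi$ admits a generator. (iii) $\Phi$ admits a weak generator.
   Context: $Act(G,X)$ is the set of uniformly continuous actions of $G$ on a metric space $(X,d)$: maps $\Phi:G\times X\to X$ such that, writing $\Phi_g=\Phi(g,\cdot)$, one has $\Phi_e=\mathrm{id}_X$, $\Phi_{gh}=\Phi_g\circ\Phi_h$ for all $g,h\in G$, and each $\Phi_g$ is a homeomorphism with $\Phi_g$ and $\Phi_{g^{-1}}$ uniformly continuous (automatic if $X$ is compact). Expansive: there is $\mathfrak e>0$ such that for all $x\ne y$ in $X$ there is $g\in G$ with $d(\Phi_g(x),\Phi_g(y))>\mathfrak e$. A finite open cover $\Lambda=\{A_1,\dots,A_n\}$ of $X$ is a generator for $\Phi$ if for every family $\{U_g\}_{g\in G}$ of members of $\Lambda$, the set $\bigcap_{g\in G}\Phi_{g^{-1}}(\overline{U_g})$ contains at most one point. It is a weak generator for $\Phi$ if for every family $\{U_g\}_{g\in G}$ of members of $\Lambda$, the set $\bigcap_{g\in G}\Phi_{g^{-1}}(U_g)$ contains at most one point. *)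

(* Defs.v *)
From HB Require Import structures.
From mathcomp Require Import all_boot all_order all_algebra.
From mathcomp Require Import all_classical all_reals all_analysis.

Set Implicit Arguments.
Unset Strict Implicit.
Unset Printing Implicit Defensive.

Import Order.TTheory GRing.Theory Num.Theory.
Local Open Scope classical_set_scope.
Local Open Scope ring_scope.

Definition is_subgroup (G : groupType) (H : set G) : Prop :=
  [/\ H 1%g,
      (forall g h : G, H g -> H h -> H (g * h)%g) &
      (forall g : G, H g -> H (g^-1)%g)].

Definition finitely_generated (G : groupType) : Prop :=
  exists A : set G, finite_set A /\ smallest (@is_subgroup G) A = [set: G].

Definition homeomorphism (X Y : topologicalType) (f : X -> Y) : Prop :=
  continuous f /\
  exists f' : Y -> X, [/\ cancel f f', cancel f' f & continuous f'].

Section Actions.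
Context (R : realType) (G : groupType) (X : metricType R).
Implicit Types (Phi : G -> X -> X) (L : set (set X)).

Definition is_action Phi : Prop :=
  [/\ Phi 1%g = id,
      (forall g h : G, Phi (g * h)%g = Phi g \o Phi h) &
      (forall g : G, [/\ homeomorphism (Phi g),
                         unif_continuous (Phi g) &
                         unif_continuous (Phi (g^-1)%g)])].

Definition expansive Phi : Prop :=
  exists e : R, 0 < e /\
    forall x y : X, x <> y -> exists g : G, e < mdist (Phi g x) (Phi g y).

Definition finite_open_cover L : Prop :=
  [/\ finite_set L, (forall A, L A -> open A) & cover L id = [set: X]].

Definition generator Phi L : Prop :=
  finite_open_cover L /\
  forall U : G -> set X, (forall g, L (U g)) ->
    is_subset1 (\bigcap_(g in [set: G]) (Phi (g^-1)%g @` closure (U g))).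

Definition weak_generator Phi L : Prop :=
  finite_open_cover L /\
  forall U : G -> set X, (forall g, L (U g)) ->
    is_subset1 (\bigcap_(g in [set: G]) (Phi (g^-1)%g @` U g)).

End Actions.

(* Main.v *)
Require Import Defs.
From mathcomp Require Import all_boot all_order all_algebra.
From mathcomp Require Import all_classical all_reals all_analysis.
Import Order.TTheory GRing.Theory Num.Theory.
Local Open Scope classical_set_scope.
Local Open Scope ring_scope.

(** The equivalence is the cycle: expansive, then generator, then weak
    generator, then expansive.

    For an action, a point [x] lies in the intersection over [g] of the sets
    [Phi g^-1 @` V g] exactly when its orbit follows the itinerary [V], that is
    [Phi g x] lies in [V g] for every [g] ([bigcap_image_action]).  Thus a
    cover is a generator when an itinerary through closures of its members
    determines the point, and a weak generator when an itinerary through its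
    members does.

    If [e] is an expansivity constant, compactness yields a finite cover by
    balls of radius [e / 4] ([compact_totally_bounded]); the closure of such a
    ball lies in the ball of radius [e / 2], so two orbits with the same
    itinerary stay within distance [e] of each other and their starting points
    coincide.  A generator is a weak generator because a set is included in its
    closure.  Finally, if [d] is a Lebesgue number of a weak generator
    ([compact_lebesgue_number]), two orbits that always stay within distance
    less than [d] share an itinerary, hence coincide; so [d / 2] is an
    expansivity constant. *)

(** For a finite [D], the set of finite supersets of [D] is a neighbourhood of
    infinity in the directed set of finite subsets of [X]; applied to the
    filter of these neighbourhoods, the near-covering form of compactness gives
    finite subcovers without a base point, so [X] may be empty. *)
Lemma compact_totally_bounded {R : realType} {X : pseudoMetricType R} (r : R) :
  compact [set: X] -> 0 < r ->
  exists2 D : set X, finite_set D & forall x, exists2 c, D c & ball c r x.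
Proof.
move=> /compact_near_coveringP cX r0.
pose F := filter_from [set D : set X | finite_set D]
  (fun D => [set E | finite_set E /\ D `<=` E]).
have FF : Filter F.
  apply: filter_from_filter; first by exists set0; exact: finite_set0.
  move=> D E finD finE; exists (D `|` E); first by rewrite /= finite_setU.
  by move=> H [finH]; rewrite subUset => -[DH EH].
have [x _|D finD cov] :=
    cX _ F (fun D x => exists2 c, D c & ball c r x) FF.
  exists (ball x r, [set E | finite_set E /\ [set x] `<=` E]); first split.
  - exact: nbhsx_ballx.
  - by exists [set x]; first exact: finite_set1.
  - by move=> [y E] /= [xy [_ xE]]; exists x => //; exact: xE.
by exists D => // x; exact: (cov D (conj finD (fun=> id))).
Qed.

(** A ball contained in a member of the cover still is, after halving its
    radius and moving its centre by less than that half; so each point has a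
    neighbourhood on which one radius works, and compactness makes the radius
    uniform. *)
Lemma compact_lebesgue_number {R : realType} {X : pseudoMetricType R}
    {L : set (set X)} :
  compact [set: X] -> (forall A, L A -> open A) -> cover L id = [set: X] ->
  exists2 d : R, 0 < d & forall x, exists2 A, L A & ball x d `<=` A.
Proof.
move=> /compact_near_coveringP cX oL covL.
have near_sub : \forall d \near (0 : R)^'+,
    [set: X] `<=` [set x | exists2 A, L A & ball x d `<=` A].
  apply: cX => x _.
  have [A LA Ax] : cover L id x by rewrite covL.
  have /nbhs_ballP[e /= e0 eA] := open_nbhs_nbhs (conj (oL _ LA) Ax).
  have e20 : 0 < e / 2 by rewrite divr_gt0.
  exists (ball x (e / 2), [set d | d <= e / 2]); first split => /=.
  - exact: nbhsx_ballx.
  - exact: nbhs_right_le.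
  - move=> [y d] /= [xy de]; exists A => // z yz; apply: eA.
    exact: (ball_split xy (le_ball de yz)).
near (0 : R)^'+ => d; exists d => // x.
suff : [set: X] `<=` [set x | exists2 A, L A & ball x d `<=` A] by exact.
by near: d.
Unshelve. all: by end_near.
Qed.

Lemma closure_ball_half {R : realFieldType} {X : pseudoMetricType R} {c : X}
    {r : R} : 0 < r -> closure (ball c (r / 2)) `<=` ball c r.
Proof.
move=> r0 y /(_ (ball y (r / 2))) [|z [cz yz]].
  by apply: nbhsx_ballx; rewrite divr_gt0.
exact: (ball_split cz (ball_sym yz)).
Qed.

Lemma open_mball (R : realFieldType) (X : metricType R) (c : X) (r : R) :
  open (ball c r).
Proof.
rewrite openE => y; rewrite ballEmdist /= => cyr.
apply/nbhs_ballP; exists (r - mdist c y); first by rewrite /= subr_gt0.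
move=> z; rewrite !ballEmdist /= ltrBrDl; apply: le_lt_trans.
exact: metric_triangle.
Qed.

Lemma bigcap_image_action {R : realType} {G : groupType} {X : metricType R}
    {Phi : G -> X -> X} (aPhi : is_action Phi) {V : G -> set X} {x : X} :
  (\bigcap_(g in [set: G]) (Phi (g^-1)%g @` V g)) x <->
  forall g, V g (Phi g x).
Proof.
have [Phi1 PhiM _] := aPhi.
have PhiK g y : Phi g (Phi g^-1%g y) = y.
  by rewrite -[LHS]/((Phi g \o Phi g^-1%g) y) -PhiM mulgV Phi1.
have PhiVK g y : Phi g^-1%g (Phi g y) = y.
  by rewrite -[LHS]/((Phi g^-1%g \o Phi g) y) -PhiM mulVg Phi1.
split=> [xV g|xV g _]; last by exists (Phi g x).
by have [y Vy <-] := xV g I; rewrite PhiK.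
Qed.

Lemma expansive_generator {R : realType} {G : groupType} {X : metricType R}
    {Phi : G -> X -> X} : compact [set: X] -> is_action Phi ->
  expansive Phi -> exists L, generator Phi L.
Proof.
move=> cX aPhi [e [e0 exp_e]].
have e20 : 0 < e / 2 by rewrite divr_gt0.
have [|D finD covD] := compact_totally_bounded (e / 2 / 2) cX.
  by rewrite divr_gt0.
exists ((fun c => ball c (e / 2 / 2)) @` D); split.
  split; first exact: finite_image.
  - by move=> _ [c _ <-]; exact: open_mball.
  - apply/seteqP; split=> // x _; have [c Dc cx] := covD x.
    by exists (ball c (e / 2 / 2)) => //; exists c.
move=> U LU x y /(bigcap_image_action aPhi) xU
  /(bigcap_image_action aPhi) yU.
apply: contrapT => /exp_e[g]; apply/negP; rewrite -leNgt ltW//.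
have [c _ Uc] := LU g; move: (xU g) (yU g); rewrite -Uc.
move=> /(closure_ball_half e20) cx /(closure_ball_half e20) cy.
by have := ball_splitr cx cy; rewrite ballEmdist.
Qed.

Lemma generator_weak_generator (R : realType) (G : groupType)
    (X : metricType R) (Phi : G -> X -> X) (L : set (set X)) :
  generator Phi L -> weak_generator Phi L.
Proof.
move=> [covL genL]; split=> // U LU x y xU yU; apply: (genL U LU) => g _.
- by have [z Uz <-] := xU g I; exists z => //; exact: subset_closure.
- by have [z Uz <-] := yU g I; exists z => //; exact: subset_closure.
Qed.

Lemma weak_generator_expansive (R : realType) (G : groupType)
    (X : metricType R) (Phi : G -> X -> X) (L : set (set X)) :
  compact [set: X] -> is_action Phi ->
  weak_generator Phi L -> expansive Phi.
Proof.
move=> cX aPhi [[_ oL covL] genL].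
have [d d0 leb] := compact_lebesgue_number cX oL covL.
exists (d / 2); split; first by rewrite divr_gt0.
move=> x y xy; apply: contrapT => close; apply: xy.
have /choice[U UL] : forall g, exists A,
    [/\ L A, A (Phi g x) & A (Phi g y)].
  move=> g; have [A LA subA] := leb (Phi g x); exists A; split=> //.
    by apply: subA; exact: ballxx.
  apply: subA; rewrite ballEmdist /= ltNge; apply/negP => far.
  apply: close; exists g; apply: lt_le_trans far.
  by rewrite ltr_pdivrMr// ltr_pMr// ltr1n.
have LU g : L (U g) by have [] := UL g.
by apply: (genL U LU); apply/(bigcap_image_action aPhi) => g;
  have [] := UL g.
Qed.

Theorem theorem3p6 (R : realType) (G : groupType) (X : metricType R)
    (Phi : G -> X -> X) (hG : finitely_generated G)
    (hX : compact [set: X]) (hPhi : is_action Phi) :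
  (expansive Phi <-> exists L : set (set X), generator Phi L) /\
  ((exists L : set (set X), generator Phi L) <->
   exists L : set (set X), weak_generator Phi L).
Proof.
have expG := expansive_generator hX hPhi.
have genW : (exists L, generator Phi L) -> exists L, weak_generator Phi L.
  by move=> [L /generator_weak_generator]; exists L.
have wExp : (exists L, weak_generator Phi L) -> expansive Phi.
  by move=> [L]; exact: weak_generator_expansive.
split; first by split=> [/expG|/genW/wExp].
by split=> [/genW|/wExp/expG].
Qed.
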